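(* Let $\widetilde{\mathcal{C}}/\mathbb{Z}^d$ be a unimodular toric arrangement arising from the unimodular central arrangement $\mathcal{C}$, and let $f_i$ be the number of $i$-dimensional cells of $\widetilde{\mathcal{C}}/\mathbb{Z}^d$. Then $$\sum_{i=0}^d f_i\,q^i=\psi_\mathcal{C}(q),\qquad\text{where }\ \psi_\mathcal{C}(q)=\sum_{F\in L}\mu_L(F,\hat1)\,(-q)^{\dim F}.$$
   Context: $\mathcal{C}=\{H_1,\dots,H_n\}$ is a central arrangement in $\mathbb{R}^d$, $H_i=\{v:h_i\cdot v=0\}$ with $h_i\in\mathbb{Z}^d$, and it is unimodular: the $d\times n$ matrix $(h_1,\dots,h_n)$ has rank $d$ and all its $d\times d$ minors lie in $\{0,1,-1\}$. $L$ is the intersection lattice of $\mathcal{C}$ (all intersections of subsets of the $H_i$, including $\mathbb{R}^d$) ordered by reverse inclusion, so $\hat0=\mathbb{R}^d$ and $\hat1=\{0\}$; $\mu_L$ is its Möbius function. $\widetilde{\mathcal{C}}$ is the infinite arrangement of all hyperplanes $H_{ij}=\{v: h_i\cdot v=j\}$, $i=1,\dots,n$, $j\in\mathbb{Z}$; the toric arrangement $\widetilde{\mathcal{C}}/\mathbb{Z}^d$ is the set of images of the $H_{ij}$ in $\mathbb{T}^d=\mathbb{R}^d/\mathbb{Z}^d$, and its cells are the images in $\mathbb{T}^d$ of the cells (relatively open faces) of $\widetilde{\mathcal{C}}$; they form a cell decomposition of $\mathbb{T}^d$. *)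

(* Defs.v *)
From HB Require Import structures.
From mathcomp Require Import all_boot all_order all_algebra.
From mathcomp Require Import generic_quotient finmap.
From mathcomp Require Import boolp classical_sets functions cardinality reals.

Set Implicit Arguments.
Unset Strict Implicit.
Unset Printing Implicit Defensive.

Import Order.TTheory GRing.Theory Num.Theory.

Local Open Scope ring_scope.
Local Open Scope classical_set_scope.

Section Mobius.

Variables (T : eqType) (s : seq T) (le : rel T).

Fixpoint mobius_rec (fuel : nat) (x y : T) : int :=
  if fuel is k.+1 then
    if x == y then 1
    else if le x y then
      - \sum_(z <- s | [&& le x z, le z y & z != y]) mobius_rec k x z
    else 0
  else 0.

(* The Moebius function of the finite poset with elements s and order le. The
   recursion descends along strict chains of s, so size s steps are enough:
   see mobius_xx and mobius_xy for the defining equations. *)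
Definition mobius (x y : T) : int := mobius_rec (size s) x y.

Hypothesis (le_refl : reflexive le) (le_anti : antisymmetric le)
  (le_trans : transitive le).

Lemma mobius_rec_stable k l x y : x \in s -> y \in s ->
  (count (fun z => le x z && le z y) s <= k)%N ->
  (count (fun z => le x z && le z y) s <= l)%N ->
  mobius_rec k x y = mobius_rec l x y.
Proof.
elim: k l y => [|k IHk] [|l] y xs ys //=.
- rewrite leqn0 => /eqP c0 _; case: eqVneq => [exy|_].
    by move: c0 => /eqP; rewrite -leqn0 leqNgt -has_count => /hasPn /(_ x xs);
       rewrite exy !le_refl.
  case: ifP => // lxy.
  by move: c0 => /eqP; rewrite -leqn0 leqNgt -has_count => /hasPn /(_ x xs);
     rewrite le_refl lxy.
- move=> _; rewrite leqn0 => /eqP c0; case: eqVneq => [exy|_].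
    by move: c0 => /eqP; rewrite -leqn0 leqNgt -has_count => /hasPn /(_ x xs);
       rewrite exy !le_refl.
  case: ifP => // lxy.
  by move: c0 => /eqP; rewrite -leqn0 leqNgt -has_count => /hasPn /(_ x xs);
     rewrite le_refl lxy.
move=> ck cl; case: eqP => // _; case: ifP => // lxy; congr (- _).
rewrite big_seq_cond [RHS]big_seq_cond; apply: eq_bigr.
move=> z /andP[zs /and3P[xz zy nzy]].
have lt_count : (count (fun t => le x t && le t z) s <
    count (fun t => le x t && le t y) s)%N.
  rewrite -[X in (_ < X)%N]size_filter -(count_predC (pred1 y)).
  rewrite -[X in (X < _)%N]add0n -addSn leq_add //.
    rewrite -has_count; apply/hasP; exists y; last exact: eqxx.
    by rewrite mem_filter lxy le_refl ys.
  rewrite count_filter; apply: sub_count => t /= /andP[xt tz].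
  rewrite xt (le_trans tz zy) !andbT; apply: contraNneq nzy => ety.
  by rewrite (le_anti (x := z) (y := y)) // zy -ety tz.
by apply: IHk => //; rewrite -ltnS; apply: leq_trans lt_count _.
Qed.

Lemma mobius_xx x : x \in s -> mobius x x = 1.
Proof. by rewrite /mobius; case: s => //= a l _; rewrite eqxx. Qed.

Lemma mobius_xy x y : x \in s -> y \in s -> x != y -> le x y ->
  mobius x y = - \sum_(z <- s | [&& le x z, le z y & z != y]) mobius x z.
Proof.
move=> xs ys nxy lxy.
have E := @mobius_rec_stable (size s) (size s).+1 x y xs ys.
rewrite /mobius E ?count_size ?(leq_trans (count_size _ _)) //=.
by rewrite (negPf nxy) lxy.
Qed.

End Mobius.

Section Arrangement.

Variables (R : realType) (d n : nat) (h : 'M[int]_(d, n)).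

Definition realmx : 'M[R]_(d, n) := map_mx intr h.

Definition unimodular : Prop :=
  \rank realmx = d /\
  forall f : 'I_d -> 'I_n, {homo f : i j / (i < j)%N} ->
    \det (colsub f h) \in [:: 0; 1; -1].

Definition dotp (i : 'I_n) (v : 'cV[R]_d) : R :=
  \sum_(k < d) (h k i)%:~R * v k 0.

Definition hyperplane (i : 'I_n) : {vspace 'cV[R]_d} :=
  lker (linfun (mulmx (col i realmx)^T)).

Lemma mem_hyperplane i v : (v \in hyperplane i) = (dotp i v == 0).
Proof.
rewrite memv_ker lfunE /= /dotp; apply/eqP/eqP => [/matrixP /(_ 0 0)|H].
  by rewrite !mxE => H; rewrite -[RHS]H; apply: eq_bigr => k _; rewrite !mxE.
by apply/matrixP => a b; rewrite !ord1 !mxE -[RHS]H; apply: eq_bigr => k _;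
   rewrite !mxE.
Qed.

Definition flats : seq {vspace 'cV[R]_d} :=
  undup [seq (\bigcap_(i in A) hyperplane i)%VS | A : {set 'I_n}].

Definition flat_le (F G : {vspace 'cV[R]_d}) : bool := (G <= F)%VS.

Lemma flat_le_refl : reflexive flat_le.
Proof. exact: subvv. Qed.

Lemma flat_le_anti : antisymmetric flat_le.
Proof. by move=> F G; rewrite /flat_le andbC => /subv_anti. Qed.

Lemma flat_le_trans : transitive flat_le.
Proof. by move=> F G K GF FK; apply: subv_trans FK GF. Qed.

Definition psi : {poly int} :=
  \sum_(F <- flats) (mobius flats flat_le F 0%VS) *: (- 'X) ^+ \dim F.

(* The relatively open face, containing v, of the arrangement of all the affine
   hyperplanes {w | h_i . w = j}, j an integer: the points lying on the same
   side of (or on) each of these hyperplanes as v does. *)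
Definition face (v : 'cV[R]_d) : set 'cV[R]_d :=
  [set w | forall (i : 'I_n) (j : int),
     Num.sg (dotp i w - j%:~R) = Num.sg (dotp i v - j%:~R)].

Definition faces : set (set 'cV[R]_d) := range face.

End Arrangement.

Section Torus.

Variables (R : realType) (d : nat).

Definition zequiv (v w : 'cV[R]_d) : bool :=
  [forall k, v k 0 - w k 0 \is a Num.int].

Lemma zequiv_refl : reflexive zequiv.
Proof. by move=> v; apply/forallP => k; rewrite subrr. Qed.

Lemma zequiv_sym : symmetric zequiv.
Proof.
by move=> v w; apply: eq_forallb => k; rewrite -opprB rpredN.
Qed.

Lemma zequiv_trans : transitive zequiv.
Proof.
move=> w v u /forallP vw /forallP wu; apply/forallP => k.
by rewrite -(subrKA (w k 0)) rpredD.
Qed.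

Canonical zequiv_equiv :=
  EquivRel zequiv zequiv_refl zequiv_sym zequiv_trans.

Definition torus : Type := {eq_quot zequiv}%qT.

Definition to_torus (v : 'cV[R]_d) : torus := (\pi_({eq_quot zequiv}) v)%qT.

Lemma to_torusP v w : to_torus v = to_torus w <-> zequiv v w.
Proof. by rewrite /to_torus; split=> [/eqmodP|H] //; apply/eqmodP. Qed.

(* X is nonempty with affine hull of dimension m; U is the direction of this
   affine hull, i.e. the span of the differences y - x with y in X. *)
Definition has_dim (X : set 'cV[R]_d) (m : nat) : Prop :=
  exists (x : 'cV[R]_d) (U : {vspace 'cV[R]_d}),
    [/\ X x, \dim U = m,
        forall y, X y -> y - x \in U
      & forall W : {vspace 'cV[R]_d},
          (forall y, X y -> y - x \in W) -> (U <= W)%VS].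

End Torus.

Definition toric_cells (R : realType) (d n : nat) (h : 'M[int]_(d, n))
    (m : nat) : set (set (torus R d)) :=
  [set C | exists X : set 'cV[R]_d,
     [/\ faces h X, has_dim X m & C = @to_torus R d @` X]].

Arguments toric_cells R {d n} h m.

Definition fnum (R : realType) (d n : nat) (h : 'M[int]_(d, n)) (m : nat)
    : nat := #|` fset_set (toric_cells R h m)|%fset.

(* Main.v *)
(* Attach to a point [x] the flat [stratum x], the intersection of the
   hyperplanes [H_i] with [h_i . x] an integer: it is the direction of the face
   of [x] and depends only on the toric cell of [x].  By Moebius inversion it is
   enough to show that, for every flat [F],
   [sum (-1)^(dim C) = 1] if [F = 0] and [0] otherwise,
   where [C] ranges over the toric cells whose flat is contained in [F].

   By unimodularity [F] is cut out by a part [B] of a basis [S] such that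
   [x |-> (h_i . x)_(i in S)] identifies Z^d with Z^S.  So each such cell has a
   unique representative in the half-open box [0 <= h_i . x < 1] ([i] in [S]),
   [h_i . x = 0] ([i] in [B]), and the sum is the Euler characteristic of that
   box, computed with the subdivision given by all the [H_ij].  This sum does
   not change when the hyperplanes of one further index [e] are inserted, since a
   relatively open bounded face on which [h_e] is not constant is replaced by
   [m + 1] faces of the same dimension and [m] faces of dimension one less.  For
   the hyperplanes indexed by [S] alone it is a sum of signs over the sets
   between [B] and [S]. *)

Require Import Defs.
From HB Require Import structures.
From mathcomp Require Import all_boot all_order all_algebra.
From mathcomp Require Import generic_quotient finmap.
From mathcomp Require Import boolp classical_sets functions cardinality reals.
From mathcomp Require Import zify ring lra.

Set Implicit Arguments.
Unset Strict Implicit.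
Unset Printing Implicit Defensive.

Import Order.TTheory GRing.Theory Num.Theory.

Local Open Scope ring_scope.
Local Open Scope classical_set_scope.

(** * Position of a real number relative to the integers *)

Section FloorCeil.

Variable R : realType.
Implicit Types (a b t u : R) (k : int).

(** Encodes the face containing [a] of the line cut at the integers, so that the infinitely many
    signs in [face] become one finite datum per index. *)
Definition floorceil a : int * int := (Num.floor a, Num.ceil a).

Lemma floorceil_int a :
  ((floorceil a).1 == (floorceil a).2) = (a \is a Num.int).
Proof.
rewrite /floorceil /= ceil_floor; case: (a \is a Num.int).
  by rewrite addr0 eqxx.
by rewrite -subr_eq0 opprD addrA subrr.
Qed.

Lemma floorceil_intr k : floorceil k%:~R = (k, k).
Proof. by rewrite /floorceil intrKfloor intrKceil. Qed.

Lemma floorceil_inv_int a k : floorceil a = (k, k) -> a = k%:~R.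
Proof.
move=> e; have : a \is a Num.int by rewrite -floorceil_int e /= eqxx.
by rewrite intrEfloor => /eqP <-; case: e => ->.
Qed.

Lemma floorceil_open a k : k%:~R < a < (k + 1)%:~R -> floorceil a = (k, k + 1).
Proof.
case/andP=> h1 h2; rewrite /floorceil; congr pair.
  by apply: floor_def; rewrite (ltW h1) h2.
by apply: ceil_def; rewrite addrK h1 (ltW h2).
Qed.

Lemma floorceilP a :
  (exists2 k, a = k%:~R & floorceil a = (k, k)) \/
  (exists2 k, k%:~R < a < (k + 1)%:~R & floorceil a = (k, k + 1)).
Proof.
case: (boolP (a \is a Num.int)) => [/intrP[k ->]|na].
  by left; exists k => //; rewrite floorceil_intr.
have h : (Num.floor a)%:~R < a < (Num.floor a + 1)%:~R.
  have /andP[h1 ->] := floor_itv a; rewrite andbT lt_neqAle h1 andbT.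
  by rewrite -intrEfloor.
by right; exists (Num.floor a) => //; exact: floorceil_open.
Qed.

Lemma floorceil_sgP a b :
  (forall k, Num.sg (a - k%:~R) = Num.sg (b - k%:~R)) <->
  floorceil a = floorceil b.
Proof.
split=> [e|[e1 e2] k].
  have le k : (k%:~R <= a) = (k%:~R <= b).
    by rewrite -subr_ge0 -[RHS]subr_ge0 -[LHS]sgr_ge0 e sgr_ge0.
  have ge k : (a <= k%:~R) = (b <= k%:~R).
    by rewrite -subr_le0 -[RHS]subr_le0 -[LHS]sgr_le0 e sgr_le0.
  congr pair; apply/eqP; rewrite eq_le.
    by rewrite !floor_ge_int -(le (Num.floor a)) (le (Num.floor b)) !floor_le.
  by rewrite !ceil_le_int (ge (Num.ceil b)) -(ge (Num.ceil a)) !ceil_ge.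
have le : (k%:~R <= a) = (k%:~R <= b) by rewrite -!floor_ge_int e1.
have ge : (a <= k%:~R) = (b <= k%:~R) by rewrite -!ceil_le_int e2.
move: le ge; case: (ltgtP a k%:~R) => h1; case: (ltgtP b k%:~R) => h2 // _ _.
- by rewrite !ltr0_sg ?subr_lt0.
- by rewrite !gtr0_sg ?subr_gt0.
- by rewrite h1 h2.
Qed.

Lemma floorceil_between a b t :
  floorceil a = floorceil b -> a <= t <= b -> floorceil t = floorceil a.
Proof.
move=> [e1 e2] /andP[h1 h2]; rewrite /floorceil; congr pair; apply/eqP.
  by rewrite eq_le [X in _ && X]le_floor // e1 le_floor.
by rewrite eq_le [X in _ && X]le_ceil // e2 le_ceil.
Qed.

Lemma floorceilDr a b t : t \is a Num.int ->
  floorceil a = floorceil b -> floorceil (a + t) = floorceil (b + t).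
Proof. by move=> ti [e1 e2]; rewrite /floorceil !floorDrz // !ceilDrz // e1 e2. Qed.

Lemma floorceil_nbhs a v : (a \is a Num.int -> v = 0) ->
  exists2 e : R, 0 < e & forall u, `|u| <= e -> floorceil (a + u * v) = floorceil a.
Proof.
move=> h; case: (floorceilP a) => [[k ak _]|[k /andP[h1 h2] ->]].
  by exists 1 => // u _; rewrite h ?ak ?intr_int // mulr0 addr0.
pose m := Num.min (a - k%:~R) ((k + 1)%:~R - a).
have m0 : 0 < m by rewrite lt_min !subr_gt0 h1 h2.
have v1 : 0 < `|v| + 1 by rewrite ltr_wpDl.
(* The summand 1 keeps the denominator positive when [v = 0]; the factor 2 makes the estimate by [m]
   strict. *)
exists (m / (2 * (`|v| + 1))) => [|u hu].
  by rewrite divr_gt0 // mulr_gt0.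
have uv : `|u * v| < m.
  rewrite normrM; apply: (@le_lt_trans _ _ (`|u| * (`|v| + 1))).
    by rewrite ler_wpM2l // lerDl.
  move: hu; rewrite -(ler_pM2r v1) => /le_lt_trans; apply.
  have -> : m / (2 * (`|v| + 1)) * (`|v| + 1) = m / 2.
    by field; rewrite gt_eqF.
  lra.
move: uv; rewrite ltr_norml lt_min => /andP[]; rewrite ltrNl lt_min.
by move=> /andP[u1 u2] /andP[u3 u4]; apply: floorceil_open; apply/andP; split; lra.
Qed.

End FloorCeil.

(** * Open intervals and their subdivision by the integers *)

Section OpenIntervals.

Variable R : realType.
Implicit Types (a b t u : R) (k : int).

(** [T] runs from its infimum to its supremum: openness keeps both out of [T], convexity fills in
    what lies between. *)
Lemma bounded_open_convex (T : set R) t0 (M : R) : T t0 ->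
    (forall t, T t -> `|t| <= M) ->
    (forall t, T t -> exists2 e : R, 0 < e & T (t - e) /\ T (t + e)) ->
    (forall t u w, T t -> T u -> t <= w <= u -> T w) ->
  exists a b, a < b /\ forall t, T t <-> a < t < b.
Proof.
move=> T0 TM To Tc.
have hs : has_sup T.
  by split; [exists t0|exists M => t /TM; rewrite ler_norml => /andP[]].
have hi : has_inf T.
  by split; [exists t0|exists (- M) => t /TM; rewrite ler_norml => /andP[]].
have lt_ab t : T t -> inf T < t < sup T.
  move=> /To[e e0 [T1 T2]]; apply/andP; split.
    by apply: (@le_lt_trans _ _ (t - e)); [exact: ge_inf hi.2 _ T1|rewrite ltrBlDr ltrDl].
  by apply: (@lt_le_trans _ _ (t + e)); [rewrite ltrDl|exact: ub_le_sup hs.2 _ T2].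
exists (inf T), (sup T); split.
  by have /andP[h1 h2] := lt_ab _ T0; apply: lt_trans h1 h2.
move=> t; split; first exact: lt_ab.
case/andP=> h1 h2.
have [u1 T1 u1t] := inf_lt hi.1 h1.
have [u2 T2 u2t] := sup_gt hs.1 h2.
by apply: Tc T1 T2 _; rewrite !ltW.
Qed.

Definition intervalz (lo : int) (m : nat) : seq int :=
  [seq lo + i%:Z | i <- iota 0 m].

Lemma mem_intervalz lo m k : (k \in intervalz lo m) = (lo <= k < lo + m%:Z).
Proof.
apply/mapP/idP => [[i]|H]; first by rewrite mem_iota => ? ->; lia.
by exists `|k - lo|%N; [rewrite mem_iota; lia|lia].
Qed.

Lemma uniq_intervalz lo m : uniq (intervalz lo m).
Proof. by rewrite map_inj_uniq ?iota_uniq // => i j; lia. Qed.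

(** The unit intervals that are met start at the integers from [floor a] to [ceil b - 1]; the
    integers inside begin only at [floor a + 1]. This surplus of one preserves the Euler sum in
    [refine_fiber]. *)
Lemma floorceil_interval a b : a < b -> exists K1 K2 : seq int,
  [/\ uniq K1, uniq K2, size K1 = (size K2).+1,
      forall k, k \in K1 <-> exists2 t, a < t < b & floorceil t = (k, k + 1)
    & forall k, k \in K2 <-> exists2 t, a < t < b & floorceil t = (k, k)].
Proof.
move=> ab; pose lo := Num.floor a; pose hi := Num.ceil b.
have lohi : lo < hi by rewrite /lo floor_lt_int (lt_le_trans ab) // ceil_ge.
exists (intervalz lo `|hi - lo|%N), (intervalz (lo + 1) (`|hi - lo|%N).-1).
split; rewrite ?uniq_intervalz // ?size_map ?size_iota; first by lia.
- move=> k; rewrite mem_intervalz.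
  have -> : (lo <= k < lo + `|hi - lo|%N%:Z) = (a < (k + 1)%:~R) && (k%:~R < b).
    rewrite -floor_lt_int -ceil_gt_int -/lo -/hi; lia.
  split=> [/andP[h1 h2]|[t /andP[at_ tb] e]].
    pose p := Num.max a k%:~R; pose q := Num.min b (k + 1)%:~R.
    have k1 : k%:~R < (k + 1)%:~R :> R by rewrite ltr_int; lia.
    have pq : p < q by rewrite /p /q gt_max !lt_min ab h1 h2 k1.
    have [pa pk] : a <= p /\ k%:~R <= p by rewrite /p !le_max !lexx orbT.
    have [qb qk] : q <= b /\ q <= (k + 1)%:~R by rewrite /q !ge_min !lexx orbT.
    exists ((p + q) / 2); first by apply/andP; split; lra.
    by apply: floorceil_open; apply/andP; split; lra.
  have [e1 e2] := e; have := floor_le t; have := ceil_ge t; rewrite e1 e2 => t1 t2.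
  by rewrite (lt_le_trans at_ t1) (le_lt_trans t2 tb).
- move=> k; rewrite mem_intervalz.
  have -> : (lo + 1 <= k < lo + 1 + (`|hi - lo|%N.-1)%:Z) = (a < k%:~R) && (k%:~R < b).
    rewrite -floor_lt_int -ceil_gt_int -/lo -/hi; lia.
  split=> [h1|[t tab /floorceil_inv_int <- //]].
  by exists k%:~R => //; rewrite floorceil_intr.
Qed.

End OpenIntervals.

(** * Flats and independent sets of hyperplanes *)

Section ToricArrangement.

Variables (R : realType) (d n : nat) (h : 'M[int]_(d, n)).
Implicit Types (i : 'I_n) (v w x y : 'cV[R]_d) (A B S : {set 'I_n}).

Local Notation dotp := (@dotp R d n h).
Local Notation hyperplane := (@hyperplane R d n h).

Definition flat A : {vspace 'cV[R]_d} := (\bigcap_(i in A) hyperplane i)%VS.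

Definition lattice x : Prop := forall k, x k 0 \is a Num.int.

Lemma dotpE i v : dotp i v = (v^T *m Defs.realmx R h) 0 i.
Proof. by rewrite mxE; apply: eq_bigr => k _; rewrite !mxE mulrC. Qed.

Lemma dotpD i v w : dotp i (v + w) = dotp i v + dotp i w.
Proof. by rewrite !dotpE linearD mulmxDl mxE. Qed.

Lemma dotpN i v : dotp i (- v) = - dotp i v.
Proof. by rewrite !dotpE linearN mulNmx mxE. Qed.

Lemma dotpB i v w : dotp i (v - w) = dotp i v - dotp i w.
Proof. by rewrite dotpD dotpN. Qed.

Lemma dotpZ i (a : R) v : dotp i (a *: v) = a * dotp i v.
Proof. by rewrite !dotpE linearZ -scalemxAl mxE. Qed.

Lemma dotp0 i : dotp i 0 = 0.
Proof. by rewrite !dotpE linear0 mul0mx mxE. Qed.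

Lemma latticeN x : lattice x -> lattice (- x).
Proof. by move=> xz k; rewrite mxE rpredN. Qed.

Lemma dotp_lattice i x : lattice x -> dotp i x \is a Num.int.
Proof. by move=> xz; apply: rpred_sum => k _; rewrite rpredM ?intr_int. Qed.

Lemma mem_flat A v :
  reflect (forall i, i \in A -> dotp i v = 0) (v \in flat A).
Proof.
rewrite memvE; apply: (iffP subv_bigcapP) => H i iA; last first.
  by rewrite -memvE mem_hyperplane H.
by apply/eqP; rewrite -mem_hyperplane memvE H.
Qed.

Lemma flat_in_flats A : flat A \in flats R h.
Proof. by rewrite mem_undup; apply/mapP; exists A => //; rewrite mem_enum. Qed.

Lemma flatsP F : F \in flats R h -> exists A, F = flat A.
Proof. by rewrite mem_undup => /mapP[A _ ->]; exists A. Qed.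

Lemma uniq_flats : uniq (flats R h).
Proof. exact: undup_uniq. Qed.

(** A vector [v] of [U] off the hyperplane spans a complement of the intersection in [U]. *)
Lemma dim_cap_hyperplane (U : {vspace 'cV[R]_d}) i :
  ~~ (U <= hyperplane i)%VS -> \dim U = (\dim (U :&: hyperplane i)).+1.
Proof.
case/subvPn=> v vU vNH; have v0 : v != 0 by apply: contraNneq vNH => ->; rewrite mem0v.
have hv : dotp i v != 0 by rewrite -mem_hyperplane.
have UE : U = ((U :&: hyperplane i) + <[v]>)%VS.
  apply/eqP; rewrite eqEsubv subv_add capvSl /= -memvE vU andbT.
  apply/subvP => u uU; rewrite -[u](subrK ((dotp i u / dotp i v) *: v)).
  apply: memv_add; last by rewrite memvZ // memv_line.
  rewrite memv_cap memvB ?memvZ //= mem_hyperplane dotpB dotpZ divfK //.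
  by rewrite subrr.
rewrite {1}UE dimv_disjoint_sum; last first.
  apply/eqP; rewrite -subv0; apply/subvP => u; rewrite memv_cap => /andP[].
  rewrite memv_cap => /andP[_ uH] /vlineP[k uk]; move: uH.
  rewrite mem_hyperplane uk dotpZ mulf_eq0 (negPf hv) orbF => /eqP ->.
  by rewrite scale0r mem0v.
by rewrite dim_vline v0 addn1.
Qed.

Lemma flatU1 i A : flat (i |: A) = (flat A :&: hyperplane i)%VS.
Proof.
apply/vspaceP => v; rewrite memv_cap mem_hyperplane.
apply/mem_flat/andP => [H|[/mem_flat H /eqP Hi] j]; last first.
  by rewrite in_setU1 => /orP[/eqP ->|/H].
split; last by rewrite H ?setU11.
by apply/mem_flat => j jA; rewrite H // setU1r.
Qed.

Lemma flat0 : flat finset.set0 = fullv.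
Proof. by rewrite /flat big_set0. Qed.

Lemma flatS A B : A \subset B -> (flat B <= flat A)%VS.
Proof.
by move=> /fintype.subsetP AB; apply/subvP => v /mem_flat H; apply/mem_flat => i /AB /H.
Qed.

(** Linear independence of the normals [h_i], expressed by the codimension of the flat. *)
Definition indep S := (\dim (flat S) + #|S| == d)%N.

Lemma indep0 : indep finset.set0.
Proof. by rewrite /indep flat0 cards0 addn0 dimvf /dim /= muln1. Qed.

Lemma indepU1 i S : indep S -> ~~ (flat S <= hyperplane i)%VS -> indep (i |: S).
Proof.
move=> /eqP iS nS; rewrite /indep flatU1 cardsU1.
have -> : i \notin S.
  apply: contra nS => iS'; apply/subvP => v /mem_flat H.
  by rewrite mem_hyperplane H.
by rewrite add1n addnS -addSn -dim_cap_hyperplane // iS.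
Qed.

(** Take [S] maximal among the independent sets between [B] and [A]: an [i] in [A] whose hyperplane
    did not contain [flat S] could still be added. *)
Lemma indep_max B A : indep B -> B \subset A ->
  exists S, [/\ B \subset S, S \subset A, indep S & flat S = flat A].
Proof.
move=> iB BA; have PB : indep B && (B \subset A) by rewrite iB.
have [S /maxsetP[/andP[iS SA] maxS] BS] :=
  @maxset_exists _ (fun S => indep S && (S \subset A)) _ PB.
exists S; split=> //; apply/eqP; rewrite eqEsubv (flatS SA) andbT.
apply/subv_bigcapP => i iA; apply/negPn/negP => nSi.
have /(maxS _) E : indep (i |: S) && (i |: S \subset A).
  by rewrite indepU1 //= finset.subUset finset.sub1set iA.
move: nSi; rewrite -E ?finset.subsetUr //; apply/negP; rewrite negbK.
by rewrite flatU1 capvSr.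
Qed.

Lemma sorted_enum_ord S : sorted (fun i j : 'I_n => (i < j)%N) (enum S).
Proof.
rewrite /enum_mem sorted_filter //; first by move=> a b c; apply: ltn_trans.
rewrite -enumT; have := @sorted_map _ _ (val : 'I_n -> nat) ltn (enum 'I_n).
by rewrite val_enum_ord iota_ltn_sorted => <-.
Qed.

(** [unimodular] speaks of minors along increasing maps, so [S] is listed in increasing order. *)
Lemma basis_fun S : #|S| = d -> exists f : 'I_d -> 'I_n,
  {homo f : i j / (i < j)%N} /\ forall i, (i \in S) = (i \in codom f).
Proof.
move=> cS; exists (fun j => enum_val (cast_ord (esym cS) j)); split.
- move=> i j ij; have x0 : 'I_n by apply: (enum_val (cast_ord (esym cS) i)).
  rewrite !(enum_val_nth x0).
  apply: (sorted_ltn_nth _ _ (sorted_enum_ord S)) => //=.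
  + by move=> a b c; apply: ltn_trans.
  + by rewrite inE -cardE cS.
  + by rewrite inE -cardE cS.
move=> i; apply/idP/codomP => [iS|[j ->]]; last exact: enum_valP.
exists (cast_ord cS (enum_rank_in iS i)).
by rewrite cast_ordK enum_rankK_in.
Qed.

(** * Bases and integral coordinates under unimodularity *)

Hypothesis h_uni : unimodular R h.

Lemma flatT : flat finset.setT = 0%VS.
Proof.
have [rk _] := h_uni; apply/eqP; rewrite -subv0; apply/subvP => v /mem_flat H.
have fr : row_free (Defs.realmx R h) by rewrite /row_free rk.
suff : v^T = 0 by move=> /(congr1 trmx); rewrite trmxK trmx0 => ->; rewrite mem0v.
apply: (row_free_inj fr); rewrite mul0mx; apply/matrixP => a i.
by rewrite !ord1 -dotpE H ?inE // mxE.
Qed.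

Definition basis S := indep S && (flat S == 0%VS).

Lemma card_basis S : basis S -> #|S| = d.
Proof. by case/andP=> /eqP iS /eqP FS; rewrite -iS FS dimv0. Qed.

Lemma basis_adapted A : exists B S,
  [/\ B \subset A, B \subset S, indep B, flat B = flat A & basis S].
Proof.
have [B [_ BA iB FB]] := indep_max indep0 (finset.sub0set A).
have [S [BS _ iS FS]] := indep_max iB (finset.subsetT B).
by exists B, S; split=> //; rewrite /basis iS FS flatT /=.
Qed.

(** The left kernel of the real submatrix lies, up to transposition, in [flat S], which is zero. So
    the minor is nonzero, hence 1 or -1, and the submatrix is invertible over the integers too. *)
Lemma basis_unitmx S (f : 'I_d -> 'I_n) : basis S ->
    {homo f : i j / (i < j)%N} -> (forall i, (i \in S) = (i \in codom f)) ->
  colsub f h \in unitmx /\ colsub f (Defs.realmx R h) \in unitmx.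
Proof.
move=> /andP[_ /eqP FS] fm fS; have [_ /(_ f fm) dt] := h_uni.
have uR : colsub f (Defs.realmx R h) \in unitmx.
  rewrite -row_free_unit; apply/row_freeP; apply/row_freeP.
  rewrite -kermx_eq0; apply/eqP/row_matrixP => j; rewrite row0.
  set u := row j _.
  have : u *m colsub f (Defs.realmx R h) = 0.
    by rewrite /u -row_mul mulmx_ker row0.
  rewrite mulmx_colsub => /matrixP ku.
  suff : u^T \in flat S by rewrite FS memv0 => /eqP/(congr1 trmx); rewrite trmxK trmx0.
  apply/mem_flat => i; rewrite fS => /codomP[k ->].
  by rewrite dotpE trmxK; have := ku 0 k; rewrite !mxE.
split=> //; rewrite unitmxE.
move: uR; rewrite unitmxE /Defs.realmx -map_mxsub det_map_mx unitfE intr_eq0.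
by move: dt; rewrite !inE => /or3P[]/eqP -> //; rewrite ?eqxx ?unitr1 ?unitrN1.
Qed.

Lemma basis_solve S (y : 'I_n -> R) : basis S ->
  exists x, forall i, i \in S -> dotp i x = y i.
Proof.
move=> bS; have [f [fm fS]] := basis_fun (card_basis bS).
have [_ uR] := basis_unitmx bS fm fS.
pose u : 'rV[R]_d := (\row_j y (f j)) *m invmx (colsub f (Defs.realmx R h)).
exists u^T => i; rewrite fS => /codomP[k ->]; rewrite dotpE trmxK.
have := mulmxKV uR (\row_j y (f j)); rewrite mulmx_colsub => /matrixP/(_ 0 k).
by rewrite !mxE.
Qed.

Lemma basis_solve_int S (w : 'I_n -> int) : basis S ->
  exists2 z, lattice z & forall i, i \in S -> dotp i z = (w i)%:~R.
Proof.
move=> bS; have [f [fm fS]] := basis_fun (card_basis bS).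
have [uZ _] := basis_unitmx bS fm fS.
pose u : 'rV[int]_d := (\row_j w (f j)) *m invmx (colsub f h).
exists (map_mx intr u^T); first by move=> k; rewrite mxE intr_int.
move=> i; rewrite fS => /codomP[k ->].
have := mulmxKV uZ (\row_j w (f j)); rewrite mulmx_colsub => /matrixP/(_ 0 k).
rewrite !mxE => <-; rewrite rmorph_sum; apply: eq_bigr => j _.
by rewrite !mxE rmorphM mulrC.
Qed.

Lemma basis_inj S v w : basis S ->
  (forall i, i \in S -> dotp i v = dotp i w) -> v = w.
Proof.
move=> /andP[_ /eqP FS] H; apply/eqP; rewrite -subr_eq0 -memv0 -FS.
by apply/mem_flat => i iS; rewrite dotpB H // subrr.
Qed.

(** The column [e] of [G] holds the coordinates of [h_e] in the basis [S]. *)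
Lemma basis_bounded S e : basis S -> exists M : R, forall x,
  (forall i, i \in S -> `|dotp i x| <= 1) -> `|dotp e x| <= M.
Proof.
move=> bS; have [f [fm fS]] := basis_fun (card_basis bS).
have [_ uR] := basis_unitmx bS fm fS.
pose G := invmx (colsub f (Defs.realmx R h)) *m Defs.realmx R h.
exists (\sum_j `|G j e|) => x Hx.
have -> : dotp e x = \sum_j dotp (f j) x * G j e.
  rewrite dotpE -{1}(mulmxK uR x^T) -(mulmxA (_ *m _)) mxE; apply: eq_bigr => j _.
  by rewrite mulmx_colsub mxE -dotpE.
apply: (le_trans (ler_norm_sum _ _ _)); apply: ler_sum => j _.
rewrite normrM -[leRHS]mul1r ler_wpM2r //; apply: Hx.
by rewrite fS codom_f.
Qed.

(** Some lattice point [z] agrees with [x] on an independent [B] with the same flat as [A]. Then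
    [x - z] lies in [flat A], where [h_i] vanishes, so [h_i . x] is the integer [h_i . z]. *)
Lemma flat_closed A x i : (forall j, j \in A -> dotp j x \is a Num.int) ->
  (flat A <= hyperplane i)%VS -> dotp i x \is a Num.int.
Proof.
move=> Ax /subvP FA; have [B [S [BA BS _ FB bS]]] := basis_adapted A.
have [z zl zS] := basis_solve_int (fun j => Num.floor (dotp j x)) bS.
have : x - z \in hyperplane i.
  apply: FA; rewrite -FB; apply/mem_flat => j jB.
  rewrite dotpB zS ?(fintype.subsetP BS) // (floorK (Ax j _)) ?subrr //.
  exact: (fintype.subsetP BA).
by rewrite mem_hyperplane dotpB subr_eq0 => /eqP ->; apply: dotp_lattice.
Qed.

(** * Codes of faces and refinement by one more index *)

(* The entry of [i] is [(k, k)] when [x] lies on [H_ik] and [(k, k + 1)] when it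
   lies strictly between [H_ik] and [H_i(k+1)]. *)
Definition code (s : seq 'I_n) x : seq ('I_n * (int * int)) :=
  [seq (i, floorceil (dotp i x)) | i <- s].

(** The direction of the face with code [c]: only the entries [(k, k)] impose an equation. *)
Definition dir (c : seq ('I_n * (int * int))) : {vspace 'cV[R]_d} :=
  (\bigcap_(p <- c | p.2.1 == p.2.2) hyperplane p.1)%VS.

Definition euler_weight c : int := (-1) ^+ \dim (dir c).

Lemma code_eqP s x y :
  code s x = code s y <->
  forall i, i \in s -> floorceil (dotp i x) = floorceil (dotp i y).
Proof.
rewrite /code; split=> [/eq_in_map H i /H[e1 e2]|H].
  by rewrite /floorceil e1 e2.
by apply/eq_in_map => i /H ->.
Qed.

Lemma dir_cons p c :
  dir (p :: c) = if p.2.1 == p.2.2 then (dir c :&: hyperplane p.1)%VS else dir c.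
Proof. by rewrite /dir big_cons capvC. Qed.

Lemma mem_dir s x v :
  reflect (forall i, i \in s -> dotp i x \is a Num.int -> dotp i v = 0)
          (v \in dir (code s x)).
Proof.
elim: s => [|e s IH] /=; first by rewrite /dir big_nil memvf; constructor.
rewrite dir_cons floorceil_int /=; case: ifP => xe; last first.
  apply: (iffP IH) => H i; last by move=> si; apply: H; rewrite inE si orbT.
  by rewrite inE => /orP[/eqP ->|/H//]; rewrite xe.
rewrite memv_cap mem_hyperplane; apply: (iffP andP) => [[/IH H /eqP ve] i|H].
  by rewrite inE => /orP[/eqP ->|/H].
split; last by rewrite H ?mem_head.
by apply/IH => i si; apply: H; rewrite inE si orbT.
Qed.

(** Integral values stay fixed along [v] and the others have room to move; the list is finite, so
    the least radius serves. *)
Lemma code_nbhs s x v : v \in dir (code s x) ->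
  exists2 e : R, 0 < e & forall u, `|u| <= e -> code s (x + u *: v) = code s x.
Proof.
elim: s => [|i s IH] /mem_dir H; first by exists 1.
have /IH[e1 e10 H1] : v \in dir (code s x).
  by apply/mem_dir => j sj; apply: H; rewrite inE sj orbT.
have [e2 e20 H2] := floorceil_nbhs (H i (mem_head _ _)).
exists (Num.min e1 e2) => [|u]; first by rewrite lt_min e10.
by rewrite le_min => /andP[u1 u2]; rewrite /= H1 // dotpD dotpZ H2.
Qed.

Lemma code_convex s x y (t : R) : code s x = code s y -> 0 <= t <= 1 ->
  code s (x + t *: (y - x)) = code s x.
Proof.
move=> /code_eqP H /andP[t0 t1]; apply/code_eqP => i si.
rewrite dotpD dotpZ dotpB; have := H i si.
move: (dotp i x) (dotp i y) => a b ab.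
have [le_ab|/ltW le_ba] := leP a b.
  by apply: (floorceil_between ab); apply/andP; split; nra.
by rewrite ab; apply: (floorceil_between (esym ab)); apply/andP; split; nra.
Qed.

Lemma code_diff_dir s x y : code s x = code s y -> y - x \in dir (code s x).
Proof.
move=> /code_eqP H; apply/mem_dir => i si /intrP[k xk].
have := H i si; rewrite xk floorceil_intr => /esym/floorceil_inv_int yk.
by rewrite dotpB xk yk subrr.
Qed.

(** [h_e] maps the face onto a point or a bounded open interval, according to whether the direction
    of the face lies in the hyperplane of [e]; [K] lists the positions met by the image. *)
Lemma refine_fiber s e x0 (M : R) :
    (forall x, code s x = code s x0 -> `|dotp e x| <= M) ->
  exists K : seq (int * int), [/\ uniq K,
    forall p, p \in K <->
      exists2 x, code s x = code s x0 & floorceil (dotp e x) = p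
  & \sum_(p <- K) euler_weight ((e, p) :: code s x0) = euler_weight (code s x0)].
Proof.
move=> Hb; set c := code s x0 in Hb *.
have [dirH|] := boolP (dir c <= hyperplane e)%VS.
  exists [:: floorceil (dotp e x0)]; split=> //.
    move=> p; rewrite inE; split=> [/eqP ->|[x cx <-]]; first by exists x0.
    have := subvP dirH _ (code_diff_dir (esym cx)).
    by rewrite mem_hyperplane dotpB subr_eq0 => /eqP ->.
  rewrite big_seq1 /euler_weight dir_cons /=.
  by case: ifP => // _; rewrite (capv_idPl dirH).
move=> dirNH; have /subvPn[v vc vNe] := dirNH; rewrite mem_hyperplane in vNe.
pose T := [set t | exists2 x, code s x = c & dotp e x = t].
have [a [b [ab Tab]]] : exists a b, a < b /\ forall t, T t <-> a < t < b.
  apply: (@bounded_open_convex _ T (dotp e x0) M); first by exists x0.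
  - by move=> t [x cx <-]; apply: Hb.
  (* Moving by [u] along [v] in either sense stays in the face and shifts the value of [h_e] both up
     and down. *)
  - move=> t [x cx <-]; rewrite -cx in vc.
    have [u u0 Hu] := code_nbhs vc; exists (u * `|dotp e v|).
      by rewrite mulr_gt0 ?normr_gt0.
    have E (w : R) : `|w| = u -> T (dotp e x + w * dotp e v).
      by move=> wu; exists (x + w *: v); [rewrite Hu ?wu|rewrite dotpD dotpZ].
    have := E u; have := E (- u); rewrite normrN gtr0_norm // mulNr.
    by case: (ger0P (dotp e v)) => _ E1 E2; rewrite ?mulrN ?opprK; split; auto.
  - move=> t u w [x cx xt] [y cy yu] /andP[tw wu].
    have [etu|ntu] := eqVneq t u.
      by exists x => //; rewrite xt; apply/eqP; rewrite eq_le tw etu wu.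
    have tu : 0 < u - t by rewrite subr_gt0 lt_neqAle ntu (le_trans tw).
    exists (x + ((w - t) / (u - t)) *: (y - x)).
      rewrite code_convex ?cx ?cy // divr_ge0 ?subr_ge0 ?(le_trans tw) //=.
      by rewrite ler_pdivrMr // mul1r lerB.
    by rewrite dotpD dotpZ dotpB xt yu divfK ?gt_eqF // addrC subrK.
have [K1 [K2 [u1 u2 sz m1 m2]]] := floorceil_interval ab.
exists ([seq (k, k + 1) | k <- K1] ++ [seq (k, k) | k <- K2]); split.
- rewrite cat_uniq !map_inj_uniq ?u1 ?u2 /=; first last.
  + by move=> k l [].
  + by move=> k l [].
  by rewrite andbT; apply/hasPn => _ /mapP[k _ ->]; apply/mapP => -[l _ []]; lia.
- move=> p; rewrite mem_cat; split.
    case/orP=> /mapP[k kK ->].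
      by have [t /Tab[x cx <-] tk] := (m1 k).1 kK; exists x.
    by have [t /Tab[x cx <-] tk] := (m2 k).1 kK; exists x.
  case=> x cx <-; have xab : a < dotp e x < b by apply/Tab; exists x.
  have [[k xk E]|[k xk E]] := floorceilP (dotp e x); rewrite E; apply/orP.
    by right; apply: map_f; apply/m2; exists (dotp e x).
  by left; apply/mapP; exists k => //; apply/m1; exists (dotp e x).
(* Open pieces keep the weight of [c], integer slices get its opposite; one copy remains since [K1]
   is longer by one. *)
rewrite big_cat !big_map /=.
rewrite (eq_bigr (fun=> euler_weight c)); last first.
  move=> k _; rewrite /euler_weight dir_cons /=; case: eqP => // ?; lia.
rewrite [X in _ + X](eq_bigr (fun=> - euler_weight c)); last first.
  move=> k _; rewrite /euler_weight dir_cons /= eqxx.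
  by rewrite (dim_cap_hyperplane dirNH) exprS mulN1r opprK.
rewrite !big_const_seq !count_predT !iter_addr_0 sz mulrS mulNrn.
by rewrite addrK.
Qed.

Definition enumerates (Q : 'cV[R]_d -> Prop) s (L : seq (seq ('I_n * (int * int)))) :=
  uniq L /\ forall c, c \in L <-> exists2 x, Q x & code s x = c.

(** The first hypothesis makes [Q] a union of faces, so each face in [L] is refined as a whole and
    the refinements are concatenated. *)
Lemma enumerates_cons Q s e (M : R) L :
    (forall x y, Q x -> code s x = code s y -> Q y) ->
    (forall x, Q x -> `|dotp e x| <= M) -> enumerates Q s L ->
  exists2 L', enumerates Q (e :: s) L' &
    \sum_(c <- L') euler_weight c = \sum_(c <- L) euler_weight c.
Proof.
move=> HQ HM [uL mL].
(* Conditioning on membership in [L] lets choice yield a total [K]; elsewhere the empty list is a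
   dummy. *)
pose P c (K : seq (int * int)) := c \in L -> [/\ uniq K,
    forall p, p \in K <-> exists2 x, code s x = c & floorceil (dotp e x) = p
  & \sum_(p <- K) euler_weight ((e, p) :: c) = euler_weight c].
have /choice[K HK] c : exists K, P c K.
  case: (boolP (c \in L)) => [cL|/negP nc]; last first.
    by exists [::] => /nc.
  have [x0 Qx0 x0c] := (mL c).1 cL.
  have Hb x : code s x = code s x0 -> `|dotp e x| <= M.
    by move=> /esym /(HQ _ _ Qx0); apply: HM.
  have [K HK] := refine_fiber Hb; by exists K => _; rewrite -x0c.
exists [seq (e, p) :: c | c <- L, p <- K c]; last first.
  rewrite big_allpairs_dep big_seq [RHS]big_seq; apply: eq_bigr => c cL.
  by have [] := HK c cL.
split.
  apply: allpairs_uniq_dep => //; first by move=> c /HK[].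
  by move=> [c p] [c' p'] _ _ [-> ->].
move=> c; split.
  case/allpairsPdep=> c' [p [c'L pK ->]]; have [_ mK _] := HK _ c'L.
  have [x xc' xp] := (mK p).1 pK; have [x0 Qx0 x0c] := (mL c').1 c'L.
  by exists x; [apply: HQ Qx0 _; rewrite x0c|rewrite /= xc' xp].
case=> x Qx <-; have xL : code s x \in L by apply/mL; exists x.
have [_ mK _] := HK _ xL; apply/allpairsPdep.
exists (code s x), (floorceil (dotp e x)); split=> //.
by apply/mK; exists x.
Qed.

(** * Half-open boxes and their Euler characteristic *)

Definition half_open_box B S x := forall i, i \in S ->
  floorceil (dotp i x) = (0, 0) \/ i \notin B /\ floorceil (dotp i x) = (0, 1).

(** [T] is the set of coordinates equal to 0; the others lie strictly between 0 and 1. *)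
Definition box_code S (T : {set 'I_n}) : seq ('I_n * (int * int)) :=
  [seq (i, if i \in T then (0, 0) else (0, 1)) | i <- enum S].

Lemma dir_box_code S (T : {set 'I_n}) : T \subset S -> dir (box_code S T) = flat T.
Proof.
move=> /fintype.subsetP TS; rewrite /dir /box_code big_map big_enum_cond /=.
by apply: eq_bigl => i /=; case: ifP => [/TS ->|_]; rewrite ?andbF.
Qed.

Lemma box_code_inj S (T T' : {set 'I_n}) : T \subset S -> T' \subset S ->
  box_code S T = box_code S T' -> T = T'.
Proof.
move=> /fintype.subsetP TS /fintype.subsetP TS' /eq_in_map H; apply/setP => i.
have := H i; rewrite mem_enum.
case: (boolP (i \in S)) => [_ /(_ isT)|nS _]; first by do 2!case: (i \in _).
by rewrite (contraNF (TS i) nS) (contraNF (TS' i) nS).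
Qed.

(** If some [j] of [S] is not in [B], toggling [j] pairs the sets [T], and the dimensions in a pair
    differ by one, so everything cancels. *)
Lemma box_sum B S : basis S -> B \subset S ->
  \sum_(T : {set 'I_n} | (B \subset T) && (T \subset S)) (-1) ^+ \dim (flat T)
    = (B == S)%:R :> int.
Proof.
move=> bS BS; have [->|nBS] := eqVneq B S.
  rewrite (big_pred1 S) => [|T]; last by rewrite /= finset.eqEsubset andbC.
  by have /andP[_ /eqP ->] := bS; rewrite dimv0.
have /fintype.properP[_ [j jS jB]] : B \proper S by rewrite finset.properEneq nBS.
rewrite (bigID (fun T : {set 'I_n} => j \in T)) /=.
rewrite (reindex_onto (fun T : {set 'I_n} => j |: T)%SET
  (fun T => T :\ j)%SET) /=; last first.
  by move=> T /andP[_ jT]; rewrite finset.setD1K.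
rewrite [X in X + _](eq_big
  (fun T : {set 'I_n} => [&& B \subset T, T \subset S & j \notin T])
  (fun T : {set 'I_n} => - (-1) ^+ \dim (flat T))); first last.
- move=> T /andP[/andP[/andP[_ TS] _] /eqP eT].
  have jT : j \notin T by rewrite -eT !inE eqxx.
  rewrite flatU1 (@dim_cap_hyperplane (flat T) j) ?exprS ?mulN1r ?opprK //.
  (* The point dual to [j] lies in [flat T] but off the hyperplane of [j]. *)
  have [x xS] := basis_solve (fun i => (i == j)%:R : R) bS.
  apply/subvPn; exists x; last by rewrite mem_hyperplane xS // eqxx oner_eq0.
  apply/mem_flat => i iT; rewrite xS.
    by case: eqP => // ij; rewrite -ij iT in jT.
  by apply: (fintype.subsetP TS); rewrite finset.setU1r.
- move=> T; rewrite finset.subUset finset.sub1set jS setU11 andbT /=.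
  case: (boolP (j \in T)) => jT.
    rewrite !andbF; apply/negbTE; rewrite negb_and; apply/orP; right.
    by apply: contraTneq jT => <-; rewrite !inE eqxx.
  rewrite setU1K // eqxx !andbT; congr andb.
  by rewrite -(setU1K jT) finset.subsetD1 jB andbT setU1K.
rewrite sumrN addrC; apply/eqP; rewrite subr_eq0; apply/eqP.
by apply: eq_bigl => T; rewrite -andbA.
Qed.

Lemma box_enumerates B S : basis S -> B \subset S ->
  exists2 L, enumerates (half_open_box B S) (enum S) L &
    \sum_(c <- L) euler_weight c = (B == S)%:R.
Proof.
move=> bS BS.
pose Ts := [seq T : {set 'I_n} <- enum {: {set 'I_n}} |
  (B \subset T) && (T \subset S)].
exists [seq box_code S T | T <- Ts]; last first.
  rewrite big_map big_filter big_enum_cond -box_sum //.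
  apply: eq_big => [T|T]; first by rewrite inE.
  by case/and3P=> _ _ TS; rewrite /euler_weight dir_box_code.
split.
  rewrite map_inj_in_uniq => [|T T']; first by apply: filter_uniq; apply: enum_uniq.
  rewrite !mem_filter => /andP[/andP[_ TS] _] /andP[/andP[_ TS'] _].
  exact: box_code_inj.
move=> c; split.
  case/mapP=> T; rewrite mem_filter => /andP[/andP[BT TS] _] ->.
  have [x xS] := basis_solve (fun i => if i \in T then 0 else 2^-1 : R) bS.
  have xE i : i \in S -> floorceil (dotp i x) = if i \in T then (0, 0) else (0, 1).
    move=> iS; rewrite xS //; case: ifP => _; first by rewrite (floorceil_intr R 0).
    by apply: floorceil_open; lra.
  exists x; last by apply/eq_in_map => i; rewrite mem_enum => /xE ->.
  move=> i iS; rewrite xE //; case: ifP => iT; [by left|right; split=> //].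
  by apply: contraFN iT; apply: (fintype.subsetP BT).
case=> x Qx <-; apply/mapP; exists [set i in S | floorceil (dotp i x) == (0, 0)]%SET.
  rewrite mem_filter mem_enum andbT; apply/andP; split; last first.
    by apply/fintype.subsetP => i; rewrite inE => /andP[].
  apply/fintype.subsetP => i iB; have iS := fintype.subsetP BS _ iB.
  by rewrite inE iS /=; case: (Qx i iS) => [->|[]] //; rewrite iB.
apply/eq_in_map => i; rewrite mem_enum inE => iS; rewrite iS /=.
by case: (Qx i iS) => [->|[_ ->]].
Qed.

(** The indices of [r] are inserted one by one; every [h_e] is bounded on the box, so each insertion
    preserves the sum. *)
Lemma euler_box B S r : basis S -> B \subset S ->
  exists2 L, enumerates (half_open_box B S) (r ++ enum S) L &
    \sum_(c <- L) euler_weight c = (B == S)%:R.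
Proof.
move=> bS BS; elim: r => [|e r [L eL <-]]; first exact: box_enumerates.
have [M HM] := basis_bounded e bS.
apply: (@enumerates_cons _ _ _ M) => //.
  move=> x y Qx /code_eqP xy i iS; rewrite -xy; first exact: Qx.
  by rewrite mem_cat mem_enum iS orbT.
move=> x Qx; apply: HM => i iS.
have : Num.floor (dotp i x) = 0 /\ (Num.ceil (dotp i x) <= 1).
  by case: (Qx i iS) => [[-> ->]|[_ [-> ->]]].
case=> fx cx; have := floor_le (dotp i x); rewrite fx => x0.
by rewrite ger0_norm // -(ceil_le_int _ 1).
Qed.

(** * Toric cells and their flats *)

Definition stratum x : {vspace 'cV[R]_d} :=
  flat [set i | dotp i x \is a Num.int]%SET.

Definition cell x : set (torus R d) := @to_torus R d @` face h x.

Lemma dir_code s x : (forall i, i \in s) -> dir (code s x) = stratum x.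
Proof.
move=> sT; apply/vspaceP => v; apply/mem_dir/mem_flat => H i.
  by rewrite inE => ?; apply: H.
by move=> _ ix; apply: H; rewrite inE.
Qed.

Lemma faceP x y :
  face h x y <-> forall i, floorceil (dotp i y) = floorceil (dotp i x).
Proof.
split=> H i; first by apply/floorceil_sgP => k; apply: H.
by move: (H i) => /floorceil_sgP.
Qed.

Lemma face_code s x y : (forall i, i \in s) ->
  face h x y <-> code s y = code s x.
Proof.
move=> sT; split=> [/faceP H|/code_eqP H]; first by apply/code_eqP => i _.
by apply/faceP => i; apply: H.
Qed.

Lemma zequivP x y : zequiv x y <-> lattice (x - y).
Proof.
split=> [/forallP H k|H]; first by rewrite !mxE.
by apply/forallP => k; have := H k; rewrite !mxE.
Qed.

(** A lattice translation shifts every [h_i . x] by an integer, hence permutes the faces. *)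
Lemma cell_eqP x y :
  cell x = cell y <-> exists2 z, lattice z & face h x (y + z).
Proof.
split=> [xy|].
  have : cell y (to_torus x) by rewrite -xy; exists x => //; apply/faceP.
  case=> w /faceP yw /to_torusP /zequivP xw; exists (- (w - x)).
    exact: latticeN.
  apply/faceP => i; rewrite dotpD (floorceilDr _ (esym (yw i))).
    by rewrite -dotpD opprB addrC subrK.
  by apply: dotp_lattice; apply: latticeN.
have sub u v : (exists2 z, lattice z & face h u (v + z)) -> cell u `<=` cell v.
  case=> z zl /faceP uvz _ [p /faceP up <-]; exists (p - z); last first.
    by apply/to_torusP/zequivP; rewrite addrAC subrr add0r; apply: latticeN.
  apply/faceP => i; rewrite dotpB.
  rewrite (@floorceilDr _ _ (dotp i (v + z))) ?up ?uvz //.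
    by rewrite dotpD addrK.
  by rewrite rpredN; apply: dotp_lattice.
move=> xy; apply/seteqP; split; apply: sub => //.
case: xy => z zl /faceP xyz; exists (- z); first exact: latticeN.
apply/faceP => i; rewrite dotpD (floorceilDr _ (esym (xyz i))).
  by rewrite -dotpD addrK.
by apply: dotp_lattice; apply: latticeN.
Qed.

Lemma stratum_face x y : face h x y -> stratum x = stratum y.
Proof.
move=> /faceP H; congr flat; apply/setP => i.
by rewrite !inE -!floorceil_int H.
Qed.

Lemma stratum_cell x y : cell x = cell y -> stratum x = stratum y.
Proof.
case/cell_eqP=> z zl /stratum_face ->; congr flat; apply/setP => i.
by rewrite !inE dotpD rpredDr // dotp_lattice.
Qed.

(** Differences within the face lie in the stratum, and by [code_nbhs] a small multiple of each
    vector of the stratum is such a difference. The base point in [has_dim] may be another point of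
    the face, with the same span. *)
Lemma has_dim_face x m : has_dim (face h x) m <-> m = \dim (stratum x).
Proof.
have sT (i : 'I_n) : i \in enum 'I_n by rewrite mem_enum.
have dimP : [/\ face h x x, forall y, face h x y -> y - x \in stratum x
  & forall W : {vspace 'cV[R]_d},
      (forall y, face h x y -> y - x \in W) -> (stratum x <= W)%VS].
  split; first exact/faceP.
    move=> y /(face_code _ _ sT) /esym/code_diff_dir.
    by rewrite dir_code.
  move=> W HW; apply/subvP => v; rewrite -(dir_code x sT) => /code_nbhs[e e0 He].
  have /HW : face h x (x + e *: v).
    by apply/(face_code _ _ sT)/He; rewrite gtr0_norm.
  rewrite addrC addKr => /(memvZ e^-1).
  by rewrite scalerA mulVf ?gt_eqF // scale1r.
split=> [[x1 [U [fx1 <- HU1 HU2]]]|->]; last first.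
  by case: dimP => fx H1 H2; exists x, (stratum x).
case: dimP => fx H1 H2; congr (\dim _); apply/eqP; rewrite eqEsubv.
apply/andP; split.
  by apply: HU2 => y fy; rewrite -[y - x1](subrKA x) memvD ?H1 // -opprB memvN H1.
by apply: H2 => y fy; rewrite -[y - x](subrKA x1) memvD ?HU1 // -opprB memvN HU1.
Qed.

(** By [stratum_cell] the chosen representative is immaterial; the default 0 serves only sets that
    are not cells. *)
Definition cell_flat (C : set (torus R d)) : {vspace 'cV[R]_d} :=
  stratum (xget 0 [set x | cell x = C]).

Lemma cell_flatE x : cell_flat (cell x) = stratum x.
Proof.
apply: stratum_cell.
exact: (@xgetPex _ 0 [set y | cell y = cell x] (ex_intro _ x erefl)).
Qed.

(** Each code of the box is sent to the cell of a chosen point [pt c], whose flat is the direction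
    of the code; this matches the codes with the cells in question, weights included. *)
Lemma euler_flat A : exists T : seq (set (torus R d)), [/\ uniq T,
  forall C, C \in T <-> exists2 x, (stratum x <= flat A)%VS & cell x = C
  & \sum_(C <- T) (-1) ^+ \dim (cell_flat C) = (flat A == 0%VS)%:R :> int].
Proof.
have [B [S [BA BS indB FB bS]]] := basis_adapted A.
pose s := enum 'I_n ++ enum S.
have sT i : i \in s by rewrite mem_cat mem_enum.
have [L [uL mL] sL] := euler_box (enum 'I_n) bS BS.
have /choice[pt Hpt] c : exists x, c \in L -> half_open_box B S x /\ code s x = c.
  case: (boolP (c \in L)) => [/mL[x]|_]; last by exists 0.
  by exists x.
have box0 x i : half_open_box B S x -> i \in S -> Num.floor (dotp i x) = 0.
  by move=> Qx /Qx[[-> _]|[_ [-> _]]].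
exists [seq cell (pt c) | c <- L]; split.
- rewrite map_inj_in_uniq // => c c' cL c'L /cell_eqP[z zl fz].
  have [Qx xc] := Hpt _ cL; have [Qy yc'] := Hpt _ c'L.
  (* Both points have floor 0 on [S], so the integers [h_i . z] vanish there. *)
  suff z0 : z = 0.
    by move: fz; rewrite z0 addr0 => /(face_code _ _ sT); rewrite xc yc'.
  apply: (basis_inj bS) => i iS; rewrite dotp0.
  have := (faceP _ _).1 fz i; rewrite dotpD => -[e _]; move: e.
  have zi := dotp_lattice i zl.
  rewrite floorDrz // (box0 _ _ Qx) // (box0 _ _ Qy) // add0r => zi0.
  by rewrite -(floorK zi) zi0.
- move=> C; split=> [/mapP[c cL ->]|[x xA <-]].
    have [Qx xc] := Hpt _ cL; exists (pt c) => //; rewrite -FB; apply: flatS.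
    apply/fintype.subsetP => i iB; rewrite inE -floorceil_int.
    by case: (Qx i (fintype.subsetP BS _ iB)) => [->|[]] //; rewrite iB.
  (* Translation by [z] removes the floors on [S] and brings [x] into the unit box. *)
  have [z zl zS] := basis_solve_int (fun i => - Num.floor (dotp i x)) bS.
  (* On [B] the translate must be exactly 0: [h_i] vanishes on [flat A], hence on the stratum of
     [x], so [flat_closed] makes [h_i . x] integral. *)
  have xB i : i \in B -> dotp i x \is a Num.int.
    move=> iB; apply: (@flat_closed [set j | dotp j x \is a Num.int]%SET).
      by move=> j; rewrite inE.
    apply: (subv_trans xA); rewrite -FB; apply/subvP => v /mem_flat H.
    by rewrite mem_hyperplane H.
  have Qx : half_open_box B S (x + z).
    move=> i iS; rewrite dotpD zS //.
    case: (boolP (dotp i x \is a Num.int)) => [ix|nix].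
      left; rewrite -[in X in X + _](floorK ix) -rmorphD /= subrr.
      exact: (floorceil_intr R 0).
    right; split; first by apply: contra nix; apply: xB.
    rewrite /floorceil floorDrz ?intr_int // ceilDrz ?intr_int //.
    by rewrite intrKfloor intrKceil subrr ceil_floor nix addrAC subrr.
  have xL : code s (x + z) \in L by apply/mL; exists (x + z).
  apply/mapP; exists (code s (x + z)) => //; apply/cell_eqP.
  have [_ yc] := Hpt _ xL.
  exists (- z); first exact: latticeN.
  apply/faceP => i; have /code_eqP/(_ i (sT i)) := yc.
  by move=> /(floorceilDr (dotp_lattice i (latticeN zl))); rewrite -!dotpD addrK.
(* If the flat is zero, independence gives [B] the size [d] of [S]. *)
have -> : (flat A == 0%VS) = (B == S).
  apply/eqP/eqP => [F0|BE]; last by rewrite -FB BE; apply/eqP; case/andP: bS.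
  apply/eqP; rewrite eqEcard BS (card_basis bS) -(eqP indB) FB F0 dimv0.
  by rewrite add0n leqnn.
rewrite big_map -sL big_seq [RHS]big_seq; apply: eq_bigr => c /Hpt[_ cE].
by rewrite cell_flatE -(dir_code _ sT) cE.
Qed.

End ToricArrangement.

(** * Moebius inversion on a finite poset *)

Lemma big_cond_D1_seq (V : nmodType) (T : eqType) (s : seq T) (P : pred T)
    (F : T -> V) j :
    uniq s -> j \in s -> P j ->
  \sum_(i <- s | P i) F i = F j + \sum_(i <- s | P i && (i != j)) F i.
Proof.
move=> us js Pj; rewrite -big_filter (bigD1_seq j) ?filter_uniq //=.
  by rewrite big_filter_cond.
by rewrite mem_filter Pj.
Qed.

(** The double sum of [mobius x z * g y] over [x <= z <= y] is evaluated twice: summing over [y]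
    first leaves only [z = t], summing over [z] first leaves only [y = x]. *)
Lemma mobius_inversion (T : eqType) (s : seq T) (le : rel T)
    (g : T -> int) (t : T) :
    reflexive le -> antisymmetric le -> transitive le -> uniq s -> t \in s ->
    (forall x, x \in s -> le x t) ->
    (forall x, x \in s -> \sum_(y <- s | le x y) g y = (x == t)%:R) ->
  forall x, x \in s -> mobius s le x t = g x.
Proof.
move=> lexx le_anti le_trans us ts le_t Hg x xs.
have muE y : y \in s -> le x y ->
    \sum_(z <- s | le x z && le z y) mobius s le x z = (x == y)%:R.
  move=> ys lxy; rewrite (big_cond_D1_seq _ us ys) ?lexx ?lxy //=.
  have [exy|nxy] := eqVneq x y.
    rewrite exy mobius_xx // big1_seq ?addr0 // => z /andP[/andP[/le_anti-> //]].
    by rewrite eqxx.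
  rewrite (mobius_xy lexx le_anti le_trans xs ys nxy lxy).
  by under eq_bigl do rewrite -andbA; rewrite addNr.
transitivity (\sum_(y <- s | le x y)
    \sum_(z <- s | le x z && le z y) mobius s le x z * g y).
  rewrite (exchange_big_dep (le x)) /=; last by move=> y z _ /andP[].
  rewrite (big_cond_D1_seq _ us ts) ?le_t //= [X in _ + X]big1_seq ?addr0;
    last move=> z /andP[/andP[lxz nzt] zs].
    rewrite -mulr_sumr -[LHS]mulr1; congr (_ * _).
    rewrite -[LHS]/(true%:R) -(eqxx t) -Hg //; apply: eq_bigl => y.
    apply/idP/andP => [lty|[]//]; split=> //.
    by apply: le_trans lty; apply: le_t.
  rewrite -mulr_sumr (eq_bigl (le z)) ?Hg ?(negPf nzt) ?mulr0 // => y.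
  rewrite lxz /=; apply/andP/idP => [[]//|lzy]; split=> //.
  exact: le_trans lxz lzy.
rewrite (big_cond_D1_seq _ us xs) ?lexx //= -mulr_suml muE ?lexx // eqxx mul1r.
rewrite big1_seq ?addr0 // => y /andP[/andP[lxy nyx] ys].
by rewrite -mulr_suml muE // eq_sym (negPf nyx) mul0r.
Qed.

Lemma card_fset_set_seq (T : choiceType) (s : seq T) (A : set T) : uniq s ->
  (forall x, A x <-> x \in s) -> finite_set A /\ #|` fset_set A|%fset = size s.
Proof.
move=> us As; have -> : A = [set` [fset x in s]%fset].
  by apply/seteqP; split=> x /=; rewrite inE /= => /As.
by rewrite set_fsetK card_fseq undup_id.
Qed.

(** * Counting toric cells by dimension and by flat *)

Theorem theorem4p1 (R : realType) (d n : nat) (h : 'M[int]_(d, n))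
    (h_neq0 : forall i : 'I_n, col i h != 0) (h_unimodular : unimodular R h) :
  (forall m : nat, finite_set (toric_cells R h m)) /\
  \sum_(m < d.+1) (fnum R h m)%:R *: 'X^m = psi R h :> {poly int}.
Proof.
(* The empty intersection is the whole space, so [T] lists all the cells. *)
have [T [uT mT _]] := euler_flat h_unimodular finset.set0.
have {}mT C : C \in T <-> exists x, @cell R d n h x = C.
  rewrite mT flat0; split=> [[x _ <-]|[x <-]]; exists x => //; exact: subvf.
pose cf := @cell_flat R d n h.
have cellsE m C : toric_cells R h m C <-> C \in [seq C <- T | \dim (cf C) == m].
  rewrite mem_filter; split=> [[_ [[x _ <-] /has_dim_face -> ->]]|].
    rewrite -/(@cell R d n h x) /cf cell_flatE eqxx /=.
    by apply/mT; exists x.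
  case/andP=> /eqP Cm /mT[x xC]; exists (face h x).
  split; [by exists x| |by rewrite -xC].
  by apply/has_dim_face; rewrite -Cm -xC /cf cell_flatE.
have cardE m := card_fset_set_seq
  (filter_uniq (fun C => \dim (cf C) == m) uT) (cellsE m).
split=> [m|]; first by have [] := cardE m.
(* The signed count of cells with flat [F], which inversion identifies with the Moebius value from
   [F] to the zero flat. *)
pose g F : int := \sum_(C <- T | cf C == F) (-1) ^+ \dim (cf C).
have cf_flats C : C \in T -> cf C \in flats R h.
  by move=> /mT[x <-]; rewrite /cf cell_flatE; apply: flat_in_flats.
have by_flat (V : nmodType) (P : pred {vspace 'cV[R]_d})
    (f : set (torus R d) -> V) :
    \sum_(C <- T | P (cf C)) f C =
    \sum_(F <- flats R h | P F) \sum_(C <- T | cf C == F) f C.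
  rewrite (exchange_big_dep (fun C => P (cf C))) /=; last by move=> F C PF /eqP ->.
  rewrite big_seq_cond [RHS]big_seq_cond; apply: eq_bigr => C /andP[CT PC].
  rewrite (@big_cond_D1_seq _ _ _ _ _ (cf C)) ?uniq_flats ?cf_flats ?PC ?eqxx //=.
  rewrite big1 ?addr0 //.
  by move=> F /andP[/andP[_ /eqP ->]]; rewrite eqxx.
have flatsum F : F \in flats R h ->
    \sum_(G <- flats R h | flat_le F G) g G = (F == 0%VS)%:R.
  move=> /flatsP[A ->]; rewrite -(by_flat _ (flat_le (flat R h A))).
  have [TA [uTA mTA <-]] := euler_flat h_unimodular A.
  rewrite -big_filter; apply: perm_big; apply: uniq_perm => //.
    exact: filter_uniq.
  move=> C; rewrite mem_filter; apply/andP/idP => [[CA /mT[x xC]]|/mTA[x xA <-]].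
    by apply/mTA; exists x => //; move: CA; rewrite -xC /cf cell_flatE.
  by rewrite /cf cell_flatE; split=> //; apply/mT; exists x.
have zero_flat : 0%VS \in flats R h by rewrite -(flatT h_unimodular) flat_in_flats.
(* Both sides are compared with a sum over cells, sorted by dimension on one side and by flat on the
   other. *)
transitivity (\sum_(C <- T) 'X^(\dim (cf C)) : {poly int}).
  rewrite (eq_bigr (fun m : 'I_d.+1 =>
      \sum_(C <- T) if \dim (cf C) == m then 'X^m else 0 : {poly int})); last first.
    move=> m _; rewrite /fnum (cardE m).2 -big_mkcond -big_filter.
    by rewrite big_const_seq count_predT iter_addr_0 scaler_nat.
  rewrite exchange_big; apply: eq_bigr => C _ /=; rewrite -big_mkcond.
  have Cd : (\dim (cf C) < d.+1)%N.
    by rewrite ltnS; have := dimvS (subvf (cf C)); rewrite dimvf /dim /= muln1.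
  by rewrite (big_pred1 (Ordinal Cd)) // => m; rewrite /= -val_eqE eq_sym.
rewrite (by_flat _ xpredT) /psi big_seq [RHS]big_seq; apply: eq_bigr => F Ff.
rewrite (@mobius_inversion _ _ _ g 0%VS) //.
(* The sign in [g] cancels that of the power of [- 'X]. *)
- rewrite /g scaler_suml; apply: eq_bigr => C /eqP ->.
  by rewrite -exprZn scaleN1r opprK.
- exact: flat_le_refl.
- exact: flat_le_anti.
- exact: flat_le_trans.
- exact: uniq_flats.
- by move=> G _; apply: sub0v.
Qed.
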